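(* Let $a\in\mathbb{R}$, let $\Gamma=\{x\in\mathbb{R}^3:x_3=a\}$, let $\Omega\subset\Gamma$ be a compact region whose boundary $\partial\Omega$ (in $\Gamma$) has two-dimensional Lebesgue measure zero, and let $\Omega^*\subset S^2_+$ be compact. Let $\mathbf m_1,\dots,\mathbf m_N$ be distinct points in $\Omega^*$, let $g_1,\dots,g_N$ be positive numbers, and let $f\in L^1(\Omega)$, $f\ge0$, with $$\int_\Omega f(x)\,dx=\sum_{i=1}^Ng_i;$$ set $\mu=\sum_{i=1}^Ng_i\,\delta_{\mathbf m_i}$. Then, given any $b_1\in\mathbb{R}$, there exist numbers $b_2,\dots,b_N\in\mathbb{R}$ such that the convex function $$\phi(x)=\max_{1\le i\le N}L(\mathbf m_i,b_i,x),\qquad x\in\Omega,$$ satisfies $$\int_{(\mathcal N_\phi)^{-1}(E)}f(x)\,dx=\mu(E)\qquad\text{for each Borel set }E\subset\Omega^* .$$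
   Context: $S^2_+=\{\mathbf m=(m_1,m_2,m_3)\in\mathbb{R}^3:|\mathbf m|=1,\ m_3>0\}$ and $\mathbf e=(0,0,1)$; $dx$ is two-dimensional Lebesgue measure on $\Gamma$. For $\mathbf m\in\Omega^*$, $b\in\mathbb{R}$, $x\in\Gamma$ let $$L(\mathbf m,b,x)=b+\big((\mathbf m\cdot\mathbf e)\,\mathbf e-\mathbf m\big)\cdot x .$$ A function $\phi:\Omega\to\mathbb{R}$ is an admissible phase refracting $\Omega$ into $\Omega^*$ if for each $x_0\in\Omega$ there exist $\mathbf m\in\Omega^*$ and $b\in\mathbb{R}$ such that $\phi(x)\ge L(\mathbf m,b,x)$ for all $x\in\Omega$, with equality at $x=x_0$; then $L(\mathbf m,b,\cdot)$ is called a supporting phase to $\phi$ at $x_0$. For an admissible phase $\phi$ and $x_0\in\Omega$, $$\mathcal N_\phi(x_0)=\{\mathbf m\in\Omega^*:\text{there exists }b\in\mathbb{R}\text{ such that }L(\mathbf m,b,\cdot)\text{ is a supporting phase to }\phi\text{ at }x_0\},$$ and for $E\subset\Omega^*$, $(\mathcal N_\phi)^{-1}(E)=\{x\in\Omega:\mathcal N_\phi(x)\cap E\neq\emptyset\}$. *)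

(* Defs.v *)
From HB Require Import structures.
From mathcomp Require Import all_boot all_order all_algebra.
From mathcomp Require Import all_classical all_reals all_analysis.

Set Implicit Arguments.
Unset Strict Implicit.
Unset Printing Implicit Defensive.

Import Order.TTheory GRing.Theory Num.Theory.
Import numFieldNormedType.Exports.

Local Open Scope classical_set_scope.
Local Open Scope ring_scope.

(* R^3 is 'rV[R]_3.  Its library topology is the usual one, but its library
   norm is the sup norm, hence the Euclidean dot and enorm.
   The third coordinate of x is x 0 ord_max. *)
Definition row3 (R : realType) (u v w : R) : 'rV[R]_3 :=
  \row_(j < 3) [:: u; v; w]`_j.

Definition dot (R : realType) (x y : 'rV[R]_3) : R :=
  \sum_(j < 3) x 0 j * y 0 j.

Definition enorm (R : realType) (x : 'rV[R]_3) : R := Num.sqrt (dot x x).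

Definition hemisphere (R : realType) : set 'rV[R]_3 :=
  [set m | enorm m = 1 /\ 0 < m 0 ord_max].

Definition e3 (R : realType) : 'rV[R]_3 := row3 0 0 1.

Definition plane (R : realType) (a : R) : set 'rV[R]_3 :=
  [set x | x 0 ord_max = a].

(* Boundary of A, a subset of plane a, in the relative topology of plane a. *)
Definition plane_boundary (R : realType) (a : R) (A : set 'rV[R]_3) :
    set 'rV[R]_3 :=
  plane a `&` closure A `&` closure (plane a `\` A).

(* Lebesgue (not just Borel) measure on R^2: the completion of the product
   measure, on the Caratheodory sigma-algebra of its outer measure. *)
Definition borel_leb2 (R : realType) :
    {measure set (measurableTypeR R * measurableTypeR R) -> \bar R} :=
  (@lebesgue_measure R \x @lebesgue_measure R)%E.

Definition lebR2 (R : realType) :=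
  caratheodory_type ((borel_leb2 R)^*)%mu.

Definition leb2 (R : realType) : {measure set (lebR2 R) -> \bar R} :=
  @completed_measure_extension _ _ R (borel_leb2 R).

(* The isometric chart R^2 -> plane a through which two-dimensional Lebesgue
   measure on plane a is read off; plane_integral a A f is the integral of f
   over the part of A lying in plane a. *)
Definition chart (R : realType) (a : R) (u : lebR2 R) : 'rV[R]_3 :=
  row3 u.1 u.2 a.

Definition plane_measurable (R : realType) (a : R) (A : set 'rV[R]_3) : Prop :=
  measurable (chart a @^-1` A).

Definition plane_measure (R : realType) (a : R) (A : set 'rV[R]_3) : \bar R :=
  leb2 R (chart a @^-1` A).

Definition plane_integrable (R : realType) (a : R) (A : set 'rV[R]_3)
    (f : 'rV[R]_3 -> R) : Prop :=
  (leb2 R).-integrable (chart a @^-1` A) (fun u => (f (chart a u))%:E).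

Definition plane_integral (R : realType) (a : R) (A : set 'rV[R]_3)
    (f : 'rV[R]_3 -> R) : \bar R :=
  (\int[leb2 R]_(u in chart a @^-1` A) (f (chart a u))%:E)%E.

Definition plane_ae (R : realType) (a : R) (P : 'rV[R]_3 -> Prop) : Prop :=
  {ae leb2 R, forall u, P (chart a u)}.

Definition borelR3 (R : realType) := g_sigma_algebraType (@open 'rV[R]_3).

Definition discrete_measure (R : realType) (n : nat) (g : 'I_n -> R)
    (m : 'I_n -> borelR3 R) (E : set (borelR3 R)) : \bar R :=
  (\sum_(i < n) (g i)%:E * \d_(m i) E)%E.

Definition Lphase (R : realType) (m : 'rV[R]_3) (b : R) (x : 'rV[R]_3) : R :=
  b + dot (dot m (e3 R) *: e3 R - m) x.

Section Phases.
Context (R : realType) (Omega Omegas : set 'rV[R]_3).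
Implicit Type phi : 'rV[R]_3 -> R.

(* A phase is a function on Omega: only its values on Omega are ever used. *)
Definition supporting_phase phi (m : 'rV[R]_3) (b : R) (x0 : 'rV[R]_3) : Prop :=
  (forall x, Omega x -> Lphase m b x <= phi x) /\ phi x0 = Lphase m b x0.

Definition admissible_phase phi : Prop :=
  forall x0, Omega x0 ->
    exists m, Omegas m /\ exists b, supporting_phase phi m b x0.

Definition phase_normal phi (x0 : 'rV[R]_3) : set 'rV[R]_3 :=
  [set m | Omegas m /\ exists b, supporting_phase phi m b x0].

Definition phase_normal_inv phi (E : set 'rV[R]_3) : set 'rV[R]_3 :=
  [set x | Omega x /\ phase_normal phi x `&` E !=set0].

End Phases.

Definition max_phase (R : realType) (n : nat) (m : 'I_n.+1 -> 'rV[R]_3)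
    (b : 'I_n.+1 -> R) (x : 'rV[R]_3) : R :=
  \big[Num.max/Lphase (m ord0) (b ord0) x]_(i < n.+1) Lphase (m i) (b i) x.

(* Main.v *)
Require Import Defs.
From HB Require Import structures.
From mathcomp Require Import all_boot all_order all_algebra.
From mathcomp Require Import all_classical all_reals all_analysis.
From mathcomp Require Import measurable_realfun ring lra.
Import Order.TTheory GRing.Theory Num.Theory.
Import numFieldNormedType.Exports.
Local Open Scope classical_set_scope.
Local Open Scope ring_scope.

Set Implicit Arguments.
Unset Strict Implicit.

(** On the plane x_3 = a the function L(m, b, .) is affine, with gradient minus
    the horizontal part of m.  The horizontal part determines m on the upper
    hemisphere, so the functions L(m_i, b_i, .) have pairwise distinct
    gradients, and the plane splits into the open convex cells where a single
    one of them dominates, up to finitely many tie lines, which are null.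

    At a point of Omega which is not on the boundary and lies in the i-th cell,
    phi is affine nearby with gradient that of L(m_i, b_i, .), so m_i is the
    only normal there ([supporting_interior]).  Hence, up to a null set, the
    preimage of E is the part of Omega in the cells with m_i in E.  The theorem
    is thereby reduced to finding heights b for which the i-th cell has
    f-mass g_i ([exists_prescribed_cells]).

    For this, fix b at the index i0 and let S be the set of heights for which
    no cell other than that of i0 exceeds its prescribed mass.
    - S is nonempty: very low heights make the other cells small.
    - S is bounded above: as the masses add up to the total, the cell of i0
      keeps at least its positive share, which fails if some height is large.
    - The coordinatewise supremum of S is in S: lowering the competitors of i
      only enlarges the i-th cell, so that the cell of the supremum is an
      increasing union of subsets of i-th cells of members of S.
    - At the supremum no cell of index i <> i0 has less than its share.
      Otherwise b i could be raised a little: the i-th cell grows continuously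
      from above because ties are null, and all the others shrink.
    Thus all the cells other than that of i0 have the right mass, and so does
    the cell of i0 by subtraction. *)

(** * Continuity of finite measures and densities *)

Section Continuity.
Context {d : measure_display} {T : measurableType d} {R : realType}.
Variable nu : {measure set T -> \bar R}.

Lemma measure_bigcup_le (F : (set T)^nat) (a : \bar R) :
  (forall k, measurable (F k)) -> nondecreasing_seq F ->
  (forall k, (nu (F k) <= a)%E) -> (nu (\bigcup_k F k) <= a)%E.
Proof.
move=> mF ndF Fa.
have cF := nondecreasing_cvg_mu (mu := nu) mF (bigcupT_measurable _ mF) ndF.
rewrite -(cvg_lim _ cF)//; apply: lime_le; last exact: nearW.
by apply/cvg_ex; exists (nu (\bigcup_k F k)).
Qed.

Lemma measure_bigcap_lt (F : (set T)^nat) (a : \bar R) :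
  (nu setT < +oo)%E -> (forall k, measurable (F k)) -> nonincreasing_seq F ->
  (nu (\bigcap_k F k) < a)%E -> exists k, (nu (F k) < a)%E.
Proof.
move=> fin mF niF capa; apply: contrapT => /forallNP Fa.
have F0 : (nu (F 0%N) < +oo)%E.
  by rewrite (le_lt_trans _ fin)// le_measure ?inE.
have cF := nonincreasing_cvg_mu (mu := nu) F0 mF (bigcapT_measurable mF) niF.
move: capa; rewrite -(cvg_lim _ cF)// ltNge => /negP; apply.
apply: lime_ge; first by apply/cvg_ex; exists (nu (\bigcap_k F k)).
by apply: nearW => k; rewrite leNgt; apply/negP; exact: Fa.
Qed.

(** The superlevel sets of a real function decrease to the empty set.  Applied
    to a difference of two functions, this makes a cell small once its height
    is low enough compared with the height of a single competitor. *)
Lemma measure_superlevel_lt (h : T -> R) (e : R) :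
  (nu setT < +oo)%E -> measurable_fun setT h -> 0 < e ->
  exists k : R, (nu [set x | (k < h x)%R] < e%:E)%E.
Proof.
move=> fin mh e0; pose F (k : nat) := [set x | k%:R < h x].
suff [k Fk] : exists k, (nu (F k) < e%:E)%E by exists k%:R.
apply: measure_bigcap_lt => //.
- move=> k; rewrite -[F k]setTI; rewrite (_ : F k = h @^-1` `]k%:R, +oo[).
    exact: mh.
  by apply/seteqP; split => x /=; rewrite in_itv/= andbT.
- move=> k l kl; apply/subsetPset => x /=; apply: le_lt_trans.
  by rewrite ler_nat.
- rewrite (_ : \bigcap_k F k = set0) ?measure0 ?lte_fin//.
  apply/seteqP; split => // x Fx.
  have := Fx (Num.bound `|h x|) I; rewrite /F /=.
  by rewrite ltNge (le_trans (ler_norm _))// ltW// archi_boundP.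
Qed.

Lemma ae_le_measure (A B : set T) : measurable A -> measurable B ->
  {ae nu, forall x, A x -> B x} -> (nu A <= nu B)%E.
Proof.
move=> mA mB [N [mN N0 ABN]].
rewrite -(measureU0 mB mN N0) le_measure ?inE//; first exact: measurableU.
move=> x Ax; have [Bx|nBx] := pselect (B x); [by left|right].
by apply: ABN => /= /(_ Ax).
Qed.

End Continuity.

Section Density.
Context {d : measure_display} {T : measurableType d} {R : realType}.
Variable mu : {measure set T -> \bar R}.

(** The measure with density f on D.  As f is nonnegative only almost
    everywhere, it is built from the positive part of f, extended by 0. *)
Lemma exists_density (D : set T) (f : T -> \bar R) : measurable D ->
  mu.-integrable D f -> {ae mu, forall x, D x -> (0 <= f x)%E} ->
  exists nu : {measure set T -> \bar R},
    (forall A, measurable A -> nu A = \int[mu]_(x in A `&` D) f x)%E /\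
    (forall P : T -> Prop, {ae mu, forall x, D x -> P x} ->
      {ae nu, forall x, P x}).
Proof.
move=> mD intf f0; pose h := f^\+%E \_ D.
have mf : measurable_fun D f := measurable_int mu intf.
have mh : measurable_fun setT h.
  by apply/(measurable_restrictT _ mD); exact: measurable_funepos.
have h0 x : (0 <= h x)%E by apply: erestrict_ge0.
pose nu0 (A : set T) := (\int[mu]_(x in A) h x)%E.
have nu0_0 : nu0 set0 = 0%E by exact: integral_set0.
have nu0_ge0 A : (0 <= nu0 A)%E by exact: integral_ge0.
have nu0_sigma : semi_sigma_additive nu0.
  exact: semi_sigma_additive_nng_induced.
pose nu : {measure set T -> \bar R} := HB.pack nu0
  (isMeasure.Build d T R nu0 nu0_0 nu0_ge0 nu0_sigma).
have nuE A : measurable A -> (nu A = \int[mu]_(x in A `&` D) f x)%E; last first.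
  exists nu; split=> // P [N [mN N0 PN]].
  have mND : measurable (N `|` ~` D).
    by apply: measurableU => //; exact: measurableC.
  exists (N `|` ~` D); split=> //.
    rewrite nuE// setIUl setICl setU0.
    apply: null_set_integral; first exact: measurableI.
      exact: measurable_funS mf.
    apply: measure_negligible (measurableI _ _ mN mD) _.
    by exists N; split=> // x [].
  move=> x nPx; have [Dx|] := pselect (D x); last by right.
  by left; apply: PN => /(_ Dx).
move=> mA; rewrite /nu /= /nu0 -integral_mkcondr.
have mAD := measurableI _ _ mA mD.
apply: ae_eq_integral => //.
- by apply: measurable_funepos; apply: measurable_funS mf.
- by apply: measurable_funS mf.
- apply: filterS f0 => x fx [_ Dx]; rewrite funeposE.
  by apply/max_idPl; exact: fx.
Qed.

Lemma complete_ae_measurable (A P : set T) : measure_is_complete mu ->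
  measurable A -> {ae mu, forall x, P x <-> A x} -> measurable P.
Proof.
move=> cmu mA [N [mN N0 PN]].
rewrite (_ : P = (A `\` N) `|` (P `&` N)).
  apply: measurableU; first exact: measurableD.
  by apply: cmu; exists N; split=> // x [].
have out x : ~ N x -> (P x <-> A x) by move=> nN; apply: contrapT => /PN.
apply/seteqP; split => x.
  have [Nx|Nx] := pselect (N x); first by right.
  by left; split=> //; exact/out.
by case=> [[Ax Nx]|[]//]; exact/out.
Qed.

End Density.

(** * Cells of prescribed mass *)

Section Semidiscrete.
Context {d : measure_display} {T : measurableType d} {R : realType}.
Variables (nu : {measure set T -> \bar R}) (n : nat) (c : 'I_n -> T -> R).
Implicit Types (b : 'I_n -> R) (i j : 'I_n) (s t : R).

(** At s = 0, the open region where c i + b i strictly dominates.  The slack s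
    serves two purposes: s < 0 exhausts the open cell from inside, and s > 0
    gives the cell obtained after raising b i by s. *)
Definition cell s b i : set T :=
  [set x | forall j, j != i -> c j x + b j < c i x + b i + s].

Hypothesis mc : forall i, measurable_fun setT (c i).

Lemma measurable_cell s b i : measurable (cell s b i).
Proof.
rewrite (_ : cell s b i = \bigcap_(j in [set j | j != i])
    [set x | c j x + b j < c i x + b i + s]); last first.
  by apply/seteqP; split.
apply: fin_bigcap_measurable => [|j _]; first exact: finite_finset.
rewrite (_ : [set x | _] = [set: T] `&`
    (fun x => c j x + b j < c i x + b i + s) @^-1` [set true]); last first.
  by rewrite setTI; apply/seteqP; split.
apply: measurable_fun_ltr => //.
  by apply: measurable_funD => //; exact: measurable_cst.
by do 2 (apply: measurable_funD => //); exact: measurable_cst.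
Qed.

(** The i-th cell grows when b i grows and when its competitors are lowered. *)
Lemma le_cell s t b b' i :
  (forall j, j != i -> b' j + b i + s <= b j + b' i + t) ->
  cell s b i `<=` cell t b' i.
Proof. by move=> bb x Cx j ji; have := Cx j ji; have := bb j ji; lra. Qed.

Lemma trivIset_cell b : trivIset setT (cell 0 b).
Proof.
move=> i j _ _ [x [Cix Cjx]]; apply: contrapT => /eqP ij.
by have := Cix j; rewrite eq_sym ij => /(_ isT); have := Cjx i ij; lra.
Qed.

Lemma cell_bigcup b i : cell 0 b i = \bigcup_k cell (- k.+1%:R^-1) b i.
Proof.
apply/seteqP; split => [x Cx|x [k _]]; last first.
  by apply: le_cell => j _; rewrite addr0 gerDl oppr_le0 invr_ge0.
suff: \forall k \near \oo, cell (- k.+1%:R^-1) b i x.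
  by move=> [k _ Ck]; exists k => //; exact: Ck (leqnn k).
apply: filter_forall => j.
have [->|ji] := eqVneq j i; first by apply: nearW.
have gap0 : 0 < c i x + b i - (c j x + b j) by have := Cx j ji; lra.
near=> k => _.
rewrite ltrBrDr addrC -ltrBrDr.
by near: k; exact: near_infty_natSinv_lt (PosNum gap0).
Unshelve. all: by end_near. Qed.

Definition closed_cell b i : set T :=
  [set x | forall j, c j x + b j <= c i x + b i].

Lemma closed_cell_bigcap b i : closed_cell b i = \bigcap_k cell k.+1%:R^-1 b i.
Proof.
apply/seteqP; split => [x Cx k _ j _|x Cx j].
  by rewrite (le_lt_trans (Cx j))// ltrDl invr_gt0.
have [->//|ji] := eqVneq j i.
apply/ler_addgt0Pr => e e0.
have [k _ /(_ _ (leqnn k))/= ke] := near_infty_natSinv_lt (PosNum e0).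
by rewrite (le_trans (ltW (Cx k I j ji)))// lerD2l ltW.
Qed.

Hypothesis untied : forall i j t, i != j ->
  {ae nu, forall x, c i x + t <> c j x}.

Lemma ae_untied b :
  {ae nu, forall x, forall i j, i != j -> c i x + b i <> c j x + b j}.
Proof.
apply: filter_forall => i; apply: filter_forall => j.
have [->|ij] := eqVneq i j; first by apply: filterE.
apply: filterS (untied (b i - b j) ij) => x + _.
by apply: contra_not => e; rewrite addrA e addrK.
Qed.

Lemma closed_cell_ae b i : {ae nu, forall x, closed_cell b i x -> cell 0 b i x}.
Proof.
apply: filterS (ae_untied b) => x ux Cx j ji.
by rewrite addr0 lt_neqAle Cx andbT; apply/eqP/ux.
Qed.

Variable i0 : 'I_n.

Lemma ae_cell b : {ae nu, forall x, exists i, cell 0 b i x}.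
Proof.
have h i := closed_cell_ae b i.
apply: filterS (filter_forall _ h) => x ux.
have [i _ imax] := arg_maxP (fun i => c i x + b i) (isT : xpredT i0).
by exists i; apply: ux => j; exact: imax.
Qed.

(** Open cells are disjoint, so the masses add up exactly; the almost sure
    description lets P absorb the ties. *)
Lemma measure_ae_cells b (I : {pred 'I_n}) (P : set T) : measurable P ->
  {ae nu, forall x, P x <-> exists2 i, i \in I & cell 0 b i x} ->
  (nu P = \sum_(i in I) nu (cell 0 b i))%E.
Proof.
move=> mP PI; have mcell i : measurable (cell 0 b i) := measurable_cell 0 b i.
rewrite -(measure_bigsetU_ord _ _ mcell (@trivIset_cell b)) -bigcup_pred.
have mU : measurable (\bigcup_(i in [set` I]) cell 0 b i).
  by rewrite bigcup_pred; exact: bigsetU_measurable.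
apply/eqP; rewrite eq_le; apply/andP; split; apply: ae_le_measure => //.
  by apply: filterS PI => x [+ _] => /[apply] -[i]; exists i.
by apply: filterS PI => x [_ Ux] [i Ii Ci]; apply: Ux; exists i.
Qed.

Lemma sum_cell b : (\sum_i nu (cell 0 b i) = nu setT)%E.
Proof.
rewrite (measure_ae_cells (b := b) (I := predT))//.
by apply: filterS (ae_cell b) => x [i Cx]; split=> // _; exists i.
Qed.

(** Semi-discrete transport: the heights are the coordinatewise supremum of
    all the heights that overload no cell other than that of i0. *)
Theorem exists_prescribed_cells (g : 'I_n -> R) (b0 : R) :
  (forall i, 0 < g i) -> nu setT = (\sum_i g i)%:E ->
  exists b, b i0 = b0 /\ forall i, nu (cell 0 b i) = (g i)%:E.
Proof.
move=> g0 nuT.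
have fin : (nu setT < +oo)%E by rewrite nuT ltry.
pose F b i := fine (nu (cell 0 b i)).
have FE b i : nu (cell 0 b i) = (F b i)%:E.
  rewrite fineK// ge0_fin_numE// (le_lt_trans _ fin)//.
  by rewrite le_measure ?inE//; exact: measurable_cell.
have sumF b : \sum_i F b i = \sum_i g i.
  apply: EFin_inj; rewrite -nuT -(sum_cell b) -sumEFin.
  by apply: eq_bigr => i _; rewrite FE.
have mB i j : measurable_fun setT (fun x => c i x - c j x).
  exact: measurable_funB.
pose S := [set b | b i0 = b0 /\ forall i, i != i0 -> F b i <= g i].
(* Only the comparison with i0 is used, so each height is chosen separately. *)
have S_ex : S !=set0.
  have /choice[k hk] i := measure_superlevel_lt fin (mB i i0) (g0 i).
  exists (fun i => if i == i0 then b0 else b0 - k i).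
  split=> [|i ii0]; first by rewrite eqxx.
  rewrite -lee_fin -FE; apply: le_trans (ltW (hk i)).
  rewrite le_measure ?inE//; first exact: measurable_cell.
    rewrite -[X in measurable X]setTI -preimage_itvoy.
    exact: mB.
  move=> x Cx; have := Cx i0; rewrite eq_sym ii0 eqxx (negbTE ii0) => /(_ isT).
  by rewrite /=; lra.
have S_i0 b : S b -> g i0 <= F b i0.
  case=> _ Sb; have := sumF b; rewrite (bigD1 i0)//= [RHS](bigD1 i0)//=.
  have : \sum_(i < n | i != i0) F b i <= \sum_(i < n | i != i0) g i.
    exact: ler_sum.
  lra.
(* A height that is too large starves the cell of i0. *)
have S_ub i : has_ubound [set b i | b in S].
  have [k hk] := measure_superlevel_lt fin (mB i0 i) (g0 i0).
  exists (b0 + `|k|) => _ [b Sb <-]; have [->|ii0] := eqVneq i i0.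
    by rewrite Sb.1 lerDl.
  rewrite leNgt; apply/negP => kb.
  have := S_i0 _ Sb; rewrite leNgt => /negP; apply.
  rewrite -lte_fin -FE; apply: le_lt_trans hk.
  rewrite le_measure ?inE//; first exact: measurable_cell.
    rewrite -[X in measurable X]setTI -preimage_itvoy.
    exact: mB.
  move=> x /(_ i ii0); rewrite Sb.1 /=; have := ler_norm k; lra.
have S_sup i : has_sup [set b i | b in S].
  by split=> //; have [b Sb] := S_ex; exists (b i), b.
pose bs i := sup [set b i | b in S].
have le_bs b i : S b -> b i <= bs i.
  by move=> Sb; apply: ub_le_sup => //; exists b.
(* A member of S whose i-th height is within 1 / (k + 1) of the supremum has
   an i-th cell containing the cell of the supremum with slack - 1 / (k + 1). *)
have Sbs : S bs.
  split=> [|i ii0].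
    apply/eqP; rewrite eq_le; apply/andP; split.
      by apply: ge_sup => [|_ [b Sb <-]]; [exact: (S_sup i0).1|rewrite Sb.1].
    by have [b Sb] := S_ex; rewrite -Sb.1 le_bs.
  rewrite -lee_fin -FE cell_bigcup; apply: measure_bigcup_le => [k|k l kl|k].
  - exact: measurable_cell.
  - apply/subsetPset; apply: le_cell => j _; rewrite lerD2l lerN2.
    by rewrite lef_pV2 ?posrE// ler_nat ltnS.
  - have k0 : 0 < k.+1%:R^-1 :> R by rewrite invr_gt0.
    have [_ [b Sb <-] kb] := sup_adherent k0 (S_sup i).
    apply: (@le_trans _ _ (nu (cell 0 b i))); last by rewrite FE lee_fin Sb.2.
    rewrite le_measure ?inE//; [exact: measurable_cell..|].
    apply: le_cell => j _; rewrite addr0 -addrA.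
    by apply: lerD; [exact: le_bs|exact: ltW].
(* With strictly less than g i, raising the i-th height by a small amount would
   stay in S, against the definition of the supremum. *)
have bs_eq i : i != i0 -> F bs i = g i.
  move=> ii0; apply/eqP; rewrite eq_le Sbs.2//= leNgt; apply/negP => Flt.
  have : (nu (\bigcap_k cell k.+1%:R^-1 bs i) < (g i)%:E)%E.
    apply: (@le_lt_trans _ _ (nu (cell 0 bs i))); last by rewrite FE lte_fin.
    apply: ae_le_measure; last first.
    - by rewrite -closed_cell_bigcap; exact: closed_cell_ae.
    - exact: measurable_cell.
    - by apply: bigcapT_measurable => k; exact: measurable_cell.
  case/measure_bigcap_lt => // [k|k l kl|k hk]; first exact: measurable_cell.
    apply/subsetPset; apply: le_cell => j _; rewrite lerD2l.
    by rewrite lef_pV2 ?posrE// ler_nat ltnS.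
  have k0 : 0 < k.+1%:R^-1 :> R by rewrite invr_gt0.
  pose b j := if j == i then bs i + k.+1%:R^-1 else bs j.
  suff Sb : S b by have := le_bs _ i Sb; rewrite /b eqxx gerDl leNgt k0.
  split=> [|j ji0]; first by rewrite /b eq_sym (negbTE ii0) Sbs.1.
  rewrite -lee_fin -FE; have [->|ji] := eqVneq j i.
    apply: le_trans (ltW hk).
    rewrite le_measure ?inE//; [exact: measurable_cell..|].
    apply: le_cell => l li; rewrite /b eqxx (negbTE li) addr0.
    by rewrite -addrA.
  apply: (@le_trans _ _ (nu (cell 0 bs j))); last by rewrite FE lee_fin Sbs.2.
  rewrite le_measure ?inE//; [exact: measurable_cell..|].
  apply: le_cell => l lj; rewrite /b (negbTE ji) !addr0 lerD2r.
  by case: eqVneq => [->|//]; rewrite lerDl ltW.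
exists bs; split=> [|i]; first exact: Sbs.1.
rewrite FE; congr _%:E; have [->|/bs_eq//] := eqVneq i i0.
have := sumF bs; rewrite (bigD1 i0)//= [RHS](bigD1 i0)//=.
by rewrite (eq_bigr _ bs_eq) => /addIr.
Qed.

End Semidiscrete.

(** * Lebesgue measure on the plane *)

Section Plane.
Context {R : realType}.
Local Notation R2 := (measurableTypeR R * measurableTypeR R)%type.

Lemma leb2_measurable (A : set R2) :
  measurable A -> measurable (A : set (lebR2 R)).
Proof. exact: caratheodory_measurable_mu_ext. Qed.

Lemma leb2E (A : set R2) : measurable A ->
  leb2 R A = (lebesgue_measure \x lebesgue_measure)%E A.
Proof. exact: measurable_mu_extE. Qed.

Lemma leb2_measurable_fun (h : R2 -> R) :
  measurable_fun setT h -> measurable_fun setT (h : lebR2 R -> R).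
Proof. by move=> mh _ B mB; apply: leb2_measurable; exact: mh. Qed.

Lemma measurable_linear (p q : R) :
  measurable_fun setT (fun u : R2 => p * u.1 + q * u.2).
Proof.
apply: measurable_funD; apply: measurable_funM => //; exact: measurable_cst.
Qed.

(** By Fubini: the vertical sections of a line that is not vertical are
    points, and a vertical line is a product with a point. *)
Lemma ae_off_line (p q t : R) : (p, q) != (0, 0) ->
  {ae leb2 R, forall u, p * u.1 + q * u.2 <> t}.
Proof.
move=> pq; exists [set u | p * u.1 + q * u.2 = t].
have mL : measurable ([set u | p * u.1 + q * u.2 = t] : set R2).
  rewrite -[X in measurable X]setTI.
  exact: measurable_linear (measurable_set1 t).
split=> [||u /contrapT//]; first exact: leb2_measurable.
rewrite leb2E//; have [q0|q0] := eqVneq q 0.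
  have p0 : p != 0 by apply: contraNneq pq => ->; rewrite q0.
  rewrite (_ : [set u | _] = [set t / p] `*` setT); last first.
    apply/seteqP; split => [[x y]/=|[x y]/= [-> _]].
      by rewrite q0 => <-; split=> //; field.
    by rewrite q0; field.
  rewrite product_measure1E//.
  by rewrite [X in (X * _)%E](lebesgue_measure_set1 _) mul0e.
apply: integral0_eq => x _ /=.
rewrite (_ : xsection _ _ = [set (t - p * x) / q]) ?lebesgue_measure_set1//.
apply/seteqP; split => y; rewrite /xsection/= inE/=.
  by move=> <-; field.
by move=> ->; field.
Qed.

(** An open set is the union of the countably many rational boxes that it
    contains. *)
Lemma open_measurable_R2 (A : set (R * R)) : open A -> measurable (A : set R2).
Proof.
move=> oA.
pose box (q : rat * rat * rat * rat) : set R2 :=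
  `]ratr q.1.1.1, ratr q.1.1.2[%classic `*` `]ratr q.1.2, ratr q.2[%classic.
rewrite (_ : A = \bigcup_(q in [set q | box q `<=` A]) box q); last first.
  apply/seteqP; split => [[x y] Axy|u [q qA /qA]//].
  have /nbhs_ballP[e /= e0 eA] := open_nbhs_nbhs (conj oA Axy).
  have rat_below (z : R) : exists q : rat, z - e < ratr q < z.
    have /rat_in_itvoo[q] : z - e < z by rewrite ltrBlDr ltrDl.
    by rewrite in_itv /=; exists q.
  have rat_above (z : R) : exists q : rat, z < ratr q < z + e.
    have /rat_in_itvoo[q] : z < z + e by rewrite ltrDl.
    by rewrite in_itv /=; exists q.
  have [q1 /andP[xq1 q1x]] := rat_below x.
  have [q2 /andP[xq2 q2x]] := rat_above x.
  have [q3 /andP[yq3 q3y]] := rat_below y.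
  have [q4 /andP[yq4 q4y]] := rat_above y.
  exists (q1, q2, q3, q4); last by rewrite /box /= !in_itv/= q1x xq2 q3y yq4.
  move=> [v w]; rewrite /box /= !in_itv/= => -[/andP[? ?] /andP[? ?]].
  by apply: eA; split; rewrite /ball/= ltr_distlC; apply/andP; split; lra.
rewrite bigcup_mkcond; apply: countable_bigcupT_measurable => // q.
by case: ifPn => // _; apply: measurableX; exact: measurable_itv.
Qed.

End Plane.

(** * Phases in the chart of the plane *)

Lemma dotE (R : realType) (x y : 'rV[R]_3) :
  dot x y = x 0 0 * y 0 0 + x 0 1 * y 0 1 + x 0 ord_max * y 0 ord_max.
Proof.
rewrite /dot !big_ord_recr big_ord0 /= add0r.
by congr (x 0 _ * y 0 _ + x 0 _ * y 0 _ + _); apply: val_inj.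
Qed.

Section Chart.
Context {R : realType}.
Variable a : R.

Lemma chart_max (u : lebR2 R) : chart a u 0 ord_max = a.
Proof. by rewrite mxE. Qed.

Lemma chart_continuous : continuous (chart a : R * R -> 'rV[R]_3).
Proof.
move=> u A /nbhs_ballP[e /= e0 eA].
apply/nbhs_ballP; exists e => //= v [uv1 uv2].
apply: eA; split=> // i j; rewrite !mxE.
by case: j => -[|[|[|//]]] ? //=; exact: ballxx.
Qed.

Lemma closed_plane_measurable (A : set 'rV[R]_3) :
  closed A -> plane_measurable a A.
Proof.
move=> cA; apply: leb2_measurable; rewrite -[X in measurable X]setCK.
apply: measurableC; apply: open_measurable_R2.
move/continuousP: chart_continuous => /(_ (~` A)); apply.
exact: closed_openC.
Qed.

(** The linear part of L(m, b, .) along the plane; the third coordinate of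
    (m . e) e - m vanishes, so the height of the plane does not enter. *)
Definition tilt (m : 'rV[R]_3) (u : lebR2 R) : R :=
  - (m 0 0 * u.1 + m 0 1 * u.2).

Lemma measurable_tilt m : measurable_fun setT (tilt m).
Proof.
by apply: leb2_measurable_fun; apply: measurable_funN; exact: measurable_linear.
Qed.

Lemma Lphase_chart m b u : Lphase m b (chart a u) = tilt m u + b.
Proof.
by rewrite /Lphase /tilt !dotE !mxE /=; ring.
Qed.

Lemma hemisphere_inj (m m' : 'rV[R]_3) : hemisphere (R:=R) m ->
  hemisphere (R:=R) m' -> m 0 0 = m' 0 0 -> m 0 1 = m' 0 1 -> m = m'.
Proof.
move=> [m1 m_gt0] [m'1 m'_gt0] e0 e1.
have sphere (x : 'rV[R]_3) : enorm x = 1 ->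
    x 0 0 ^+ 2 + x 0 1 ^+ 2 + x 0 ord_max ^+ 2 = 1.
  rewrite /enorm => /(congr1 (fun r => r ^+ 2)).
  rewrite sqr_sqrtr; last by apply: sumr_ge0 => j _; rewrite -expr2 sqr_ge0.
  by rewrite expr1n dotE !expr2.
have e2 : m 0 ord_max = m' 0 ord_max.
  apply/eqP; rewrite -(eqrXn2 (n:=2))// ?ltW//; apply/eqP.
  by have := sphere m m1; have := sphere m' m'1; rewrite e0 e1; lra.
apply/rowP => -[[|[|[|//]]] lt3].
- by rewrite (_ : Ordinal lt3 = 0) //; apply: val_inj.
- by rewrite (_ : Ordinal lt3 = 1) //; apply: val_inj.
- by rewrite (_ : Ordinal lt3 = ord_max) //; apply: val_inj.
Qed.

End Chart.

(** * Normals of a maximum of phases *)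

Section Visible.
Context {R : realType}.
Variables (a : R) (Omega Omegas : set 'rV[R]_3) (n : nat).
Variables (m : 'I_n.+1 -> 'rV[R]_3) (b : 'I_n.+1 -> R).

Local Notation mcell := (cell (fun i => tilt (m i)) 0 b).

Lemma max_phaseE (x : 'rV[R]_3) i :
  (forall j, Lphase (m j) (b j) x <= Lphase (m i) (b i) x) ->
  max_phase m b x = Lphase (m i) (b i) x.
Proof.
move=> imax; apply/eqP; rewrite eq_le; apply/andP; split.
  by apply: bigmax_le => [|j _]; exact: imax.
exact: le_bigmax.
Qed.

Lemma max_phase_chart u i : mcell i u ->
  max_phase m b (chart a u) = tilt (m i) u + b i.
Proof.
move=> Cu; rewrite -(Lphase_chart a); apply: max_phaseE => j.
rewrite !Lphase_chart.
by have [->//|ji] := eqVneq j i; have := Cu j ji; rewrite addr0 => /ltW.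
Qed.

Lemma max_phase_supporting (x : 'rV[R]_3) i :
  max_phase m b x = Lphase (m i) (b i) x ->
  supporting_phase Omega (max_phase m b) (m i) (b i) x.
Proof. by move=> xE; split=> // y _; exact: le_bigmax. Qed.

Lemma max_phase_admissible : (forall i, Omegas (m i)) ->
  admissible_phase Omega Omegas (max_phase m b).
Proof.
move=> hm x _.
have [i _ imax] := arg_maxP (fun i => Lphase (m i) (b i) x) (isT : xpredT ord0).
exists (m i); split => //; exists (b i); apply: max_phase_supporting.
by apply: max_phaseE => j; exact: imax.
Qed.

Hypothesis Omega_plane : Omega `<=` plane a.

(** A point of Omega off the relative boundary is not in the closure of the
    rest of the plane, so a short displacement in any direction v stays in
    Omega. *)
Lemma near_interior u (v : R * R) : Omega (chart a u) ->
  ~ plane_boundary a Omega (chart a u) ->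
  \forall t \near 0^'+, Omega (chart a (u.1 + t * v.1, u.2 + t * v.2)).
Proof.
move=> Ou; rewrite /plane_boundary => bd.
have : ~ closure (plane a `\` Omega) (chart a u).
  move=> clu; apply: bd; split=> //; split; first exact: Omega_plane.
  exact: subset_closure.
move=> /existsNP[B] /not_implyP[uB B0].
have line_cvg (x y : R) : x + t * y @[t --> 0^'+] --> x.
  rewrite -[X in _ --> X]addr0 -[X in _ --> _ + X](mul0r y).
  apply: cvgD; first exact: cvg_cst.
  apply: cvgM; last exact: cvg_cst.
  exact: cvg_at_right_filter cvg_id.
have path_cvg : (u.1 + t * v.1, u.2 + t * v.2) @[t --> 0^'+] --> (u.1, u.2).
  exact: (cvg_pair (line_cvg u.1 v.1) (line_cvg u.2 v.2)).
have /= : \forall t \near 0^'+, B (chart a (u.1 + t * v.1, u.2 + t * v.2)).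
  apply: (path_cvg (chart a @^-1` B)).
  by apply: (@chart_continuous _ a (u.1, u.2)); case: (u) uB.
apply: filterS => t Bt; apply: contrapT => nO; apply: B0.
exists (chart a (u.1 + t * v.1, u.2 + t * v.2)); split=> //; split=> //.
exact: chart_max.
Qed.

Lemma near_cell u (v : R * R) i : mcell i u ->
  \forall t \near 0^'+, mcell i (u.1 + t * v.1, u.2 + t * v.2).
Proof.
move=> Cu; apply: filter_forall => j.
have [->|ji] := eqVneq j i; first by apply: nearW.
set D := tilt (m j) v - tilt (m i) v.
have gap0 : 0 < tilt (m i) u + b i - (tilt (m j) u + b j).
  by have := Cu j ji; lra.
have D0 : 0 < `|D| + 1 by rewrite ltr_wpDl.
near=> t => _.
have t0 : 0 < t by [].
have : t * (`|D| + 1) < tilt (m i) u + b i - (tilt (m j) u + b j).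
  by rewrite -ltr_pdivlMr//; near: t; apply: nbhs_right_lt; rewrite divr_gt0.
have : t * D <= t * `|D| by rewrite ler_pM2l// ler_norm.
by rewrite /D /tilt /=; lra.
Unshelve. all: by end_near. Qed.

(** Close to u the phase is L(m_i, b_i, .), so the affine function
    L(m_i, b_i, .) - L(m', b', .) is nonnegative and vanishes at u.  Moving by a
    small t > 0 along v, the difference of the horizontal parts of m_i and m',
    makes it equal to - t |v|^2, which forces v = 0. *)
Lemma supporting_interior u i (m' : 'rV[R]_3) b' : Omega (chart a u) ->
  ~ plane_boundary a Omega (chart a u) -> mcell i u ->
  supporting_phase Omega (max_phase m b) m' b' (chart a u) ->
  m' 0 0 = m i 0 0 /\ m' 0 1 = m i 0 1.
Proof.
move=> Ou bd Cu [sup0 sup1].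
pose v : R * R := (m i 0 0 - m' 0 0, m i 0 1 - m' 0 1).
have : \forall t \near 0^'+, (0 : R) < t /\
    Omega (chart a (u.1 + t * v.1, u.2 + t * v.2)) /\
    mcell i (u.1 + t * v.1, u.2 + t * v.2).
  near=> t; split=> //; split; near: t.
    exact: near_interior.
  exact: near_cell.
move=> /filter_ex[t [t0 [/sup0 + Ct]]].
rewrite (max_phase_chart Ct) Lphase_chart.
move: sup1; rewrite (max_phase_chart Cu) Lphase_chart /tilt /=.
move=> e le; have : t * (v.1 ^+ 2 + v.2 ^+ 2) <= 0 by rewrite /v/=; lra.
rewrite pmulr_rle0// => vv.
have := sqr_ge0 v.1; have := sqr_ge0 v.2 => h2 h1.
have /eqP : v.1 ^+ 2 = 0 by lra.
have /eqP : v.2 ^+ 2 = 0 by lra.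
by rewrite !sqrf_eq0 /= !subr_eq0 => /eqP -> /eqP ->.
Unshelve. all: by end_near. Qed.

End Visible.

Theorem theorem5p3 (R : realType) (a : R) (Omega Omegas : set 'rV[R]_3)
    (hOmega_plane : Omega `<=` plane a) (hOmega_compact : compact Omega)
    (hOmega_bd : plane_measure a (plane_boundary a Omega) = 0%E)
    (hOmegas_sphere : Omegas `<=` hemisphere (R:=R))
    (hOmegas_compact : compact Omegas)
    (n : nat) (m : 'I_n.+1 -> 'rV[R]_3) (g : 'I_n.+1 -> R)
    (hm : forall i, Omegas (m i)) (hm_inj : injective m)
    (hg : forall i, 0 < g i)
    (f : 'rV[R]_3 -> R) (hf_int : plane_integrable a Omega f)
    (hf_ge0 : plane_ae a (fun x => Omega x -> 0 <= f x))
    (hfg : plane_integral a Omega f = (\sum_(i < n.+1) g i)%:E)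
    (b1 : R) :
  exists b : 'I_n.+1 -> R,
    [/\ b ord0 = b1,
        admissible_phase Omega Omegas (max_phase m b)
      & forall E : set 'rV[R]_3, <<s @open 'rV[R]_3 >> E -> E `<=` Omegas ->
          plane_measurable a
            (phase_normal_inv Omega Omegas (max_phase m b) E) /\
          plane_integral a
            (phase_normal_inv Omega Omegas (max_phase m b) E) f
          = discrete_measure g m E].
Proof.
pose D := chart a @^-1` Omega; pose c i := tilt (m i).
have mD : measurable D.
  apply: closed_plane_measurable; apply: compact_closed hOmega_compact.
  exact: norm_hausdorff.
have mc i : measurable_fun setT (c i) by exact: measurable_tilt.
have f0 : {ae leb2 R, forall u, D u -> (0 <= (f (chart a u))%:E)%E}.
  move: hf_ge0; rewrite /plane_ae; apply: filterS => u fu Du.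
  by rewrite lee_fin fu.
have [nu [nuE ae_nu]] := exists_density mD hf_int f0.
have ae_leb2 := ae_filter_ringOfSetsType (leb2 R).
have untied i j t : i != j -> {ae leb2 R, forall u, c i u + t <> c j u}.
  move=> ij.
  have pq : (m i 0 0 - m j 0 0, m i 0 1 - m j 0 1) != (0, 0).
    apply: contra_neq ij => -[/eqP + /eqP].
    rewrite !subr_eq0 => /eqP e0 /eqP e1.
    by apply: hm_inj; apply: hemisphere_inj e0 e1; exact: hOmegas_sphere.
  have := ae_off_line t pq.
  apply: (@filterS _ _ ae_leb2) => u; apply: contra_not.
  by rewrite /c /tilt; lra.
have nu_untied i j t : i != j -> {ae nu, forall u, c i u + t <> c j u}.
  by move=> ij; apply: ae_nu; apply: filterS (untied i j t ij).
have nuT : nu setT = (\sum_i g i)%:E by rewrite nuE// setTI -hfg.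
have [b [b0 nu_cell]] :=
  exists_prescribed_cells mc nu_untied ord0 b1 hg nuT.
exists b; split=> //; first exact: max_phase_admissible.
move=> E _ _; set N := phase_normal_inv _ _ _ _.
pose I := [pred i | m i \in E].
have N_cells : {ae leb2 R, forall u, N (chart a u) <->
    D u /\ exists2 i, i \in I & cell c 0 b i u}.
  have off_bd : {ae leb2 R, forall u, ~ plane_boundary a Omega (chart a u)}.
    exists (chart a @^-1` plane_boundary a Omega).
    split=> [|//|u /contrapT//].
    rewrite (_ : _ @^-1` _ = chart a @^-1`
        (closure Omega `&` closure (plane a `\` Omega))); last first.
      apply/seteqP; split=> u; first by move=> [[_ ? ?]].
      by move=> [? ?]; split=> //; split=> //; exact: chart_max.
    by apply: closed_plane_measurable; apply: closedI; exact: closed_closure.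
  have in_cell := ae_cell untied ord0 b.
  apply: (@filterS2 _ _ ae_leb2 _ _ _ _ off_bd in_cell) => u bd [i Cu]; split.
    move=> [Ou [m' [[Om' [b' sup]] /mem_set Em']]]; split=> //; exists i => //.
    have [e0 e1] := supporting_interior hOmega_plane Ou bd Cu sup.
    have mi : m' = m i by apply: hemisphere_inj e0 e1; exact: hOmegas_sphere.
    by rewrite mi in Em'; exact: Em'.
  move=> [Du [j Ij Cj]]; split=> //.
  exists (m j); split; last exact: set_mem Ij.
  split=> //; exists (b j).
  by apply: max_phase_supporting; rewrite Lphase_chart; exact: max_phase_chart.
have mN : plane_measurable a N.
  have mU : measurable (\bigcup_(i in [set` I]) cell c 0 b i).
    apply: fin_bigcup_measurable; first exact: finite_finset.
    by move=> i _; exact: measurable_cell.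
  apply: complete_ae_measurable (measurableI _ _ mD mU) N_cells.
  exact: measure_is_complete_caratheodory.
split=> //.
have -> : discrete_measure g m E = (\sum_(i in I) nu (cell c 0 b i))%E.
  rewrite /discrete_measure [RHS]big_mkcond /=; apply: eq_bigr => i _.
  by rewrite diracE nu_cell inE; case: ifP => _; rewrite ?mule1 ?mule0.
rewrite -(measure_ae_cells mc mN)//.
  by rewrite nuE// setIidl// => u [].
by apply: ae_nu; apply: (@filterS _ _ ae_leb2) N_cells => u /= NE Du; tauto.
Qed.
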